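(* Let $K,N\in\mathbb N$, let $(\mu^{(k)},\nu^{(k)})\in\Delta_N\times\Delta_N$, $k\in\{1,\dots,K\}$, be $K$ distinct pairs of marginals, and let $\alpha^{(k)}\in\mathbb R$ (total costs) and $\pi^{(k)}\in\Pi(\mu^{(k)},\nu^{(k)})$ (optimal transport plans), $k\in\{1,\dots,K\}$, be observed with respect to an underlying cost matrix $c\in\operatorname{Sym}_N^0$, i.e. $\mathcal T_c(\mu^{(k)},\nu^{(k)})=\alpha^{(k)}=\langle c,\pi^{(k)}\rangle$ for all $k$. For each $k$ let $\{u^{(\ell,k)}:\ell\in\{1,\dots,L_k\}\}\subseteq\operatorname{EP}(\mu^{(k)},\nu^{(k)})$ be a family of extreme points as described in the context. a) If the system $\{s(u^{(\ell,k)}):\ell\in\{1,\dots,L_k\},\ k\in\{1,\dots,K\}\}$ contains $(N-1)N/2$ linearly independent vectors, then the cost matrix $c$ is identifiable in $\operatorname{Sym}_N^0$. b) Suppose that $\operatorname{conv}\{u^{(\ell,k)}:\ell\in\{1,\dots,L_k\}\}=\operatorname{OTP}_c(\mu^{(k)},\nu^{(k)})$ for all $k\in\{1,\dots,K\}$. Then the converse holds: if $c$ is identifiable in $\operatorname{Sym}_N^0$, then $\{s(u^{(\ell,k)}):\ell\in\{1,\dots,L_k\},\ k\in\{1,\dots,K\}\}$ contains $(N-1)N/2$ linearly independent vectors.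
   Context: $\Delta_N=\{x\in\mathbb R^N: x_i\ge 0,\ \sum_i x_i=1\}$. For $\mu,\nu\in\Delta_N$, $\Pi(\mu,\nu)$ is the set of $N\times N$ matrices with nonnegative entries, row sums $\mu$ and column sums $\nu$; $\operatorname{EP}(\mu,\nu)$ is the finite set of its extreme points. For $c\in\mathbb R^{N\times N}$, $\mathcal T_c(\mu,\nu)=\min_{\pi\in\Pi(\mu,\nu)}\langle c,\pi\rangle$ (Frobenius inner product) and $\operatorname{OTP}_c(\mu,\nu)$ is the set of minimizers. $\operatorname{Sym}_N^0=\{c\in\mathbb R^{N\times N}: c_{i,i}=0\text{ and }c_{i,j}=c_{j,i}\text{ for all }i,j\in\{1,\dots,N\}\}$. For $x\in\mathbb R^{N\times N}$, $s(x)\in\mathbb R^{N(N-1)/2}$ denotes the sum of the vectorized strict upper triangular part and the correspondingly ordered vectorized strict lower triangular part of $x$, i.e. $s(x)=(x_{i,j}+x_{j,i})_{1\le i<j\le N}$. Families $u^{(\ell,k)}$: for each $k$, $L_k\in\mathbb N$ and $u^{(1,k)},\dots,u^{(L_k,k)}\in\operatorname{EP}(\mu^{(k)},\nu^{(k)})$ are such that $\pi^{(k)}=\sum_{\ell=1}^{L_k}\lambda_\ell u^{(\ell,k)}$ for some $\lambda\in\Delta_{L_k}$ with all $\lambda_\ell>0$, and $\operatorname{conv}\{u^{(\ell,k)}:\ell\in\{1,\dots,L_k\}\}\subseteq\operatorname{OTP}_c(\mu^{(k)},\nu^{(k)})$. (Such families always exist, e.g. all vertices of the smallest face of $\Pi(\mu^{(k)},\nu^{(k)})$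 containing $\pi^{(k)}$.) A cost matrix $\tilde c$ is consistent if $\mathcal T_{\tilde c}(\mu^{(k)},\nu^{(k)})=\alpha^{(k)}=\langle\tilde c,\pi^{(k)}\rangle$ for all $k$. The cost matrix $c$ is identifiable in $\operatorname{Sym}_N^0$ if $c$ is the only consistent cost matrix belonging to $\operatorname{Sym}_N^0$. *)

(* Defs.v *)
From HB Require Import structures.
From mathcomp Require Import all_boot all_order all_algebra.
From mathcomp Require Import all_classical all_reals all_analysis.

Set Implicit Arguments.
Unset Strict Implicit.
Unset Printing Implicit Defensive.

Import Order.TTheory GRing.Theory Num.Theory.
Import numFieldNormedType.Exports.

Local Open Scope classical_set_scope.
Local Open Scope ring_scope.

Section Convexity.
Context {R : realType}.

Definition simplex (n : nat) : set 'rV[R]_n :=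
  [set x | (forall i, 0 <= x 0 i) /\ \sum_i x 0 i = 1].

Definition extreme_points (E : lmodType R) (A : set E) : set E :=
  [set x | A x /\ forall (y z : E) (t : R), A y -> A z -> 0 < t < 1 ->
                    x = t *: y + (1 - t) *: z -> y = x /\ z = x].

Definition conv_family (E : lmodType R) (L : nat) (v : 'I_L -> E) : set E :=
  [set \sum_l lambda 0 l *: v l | lambda in @simplex L].

Definition contains_free (E : vectType R) (S : set E) (m : nat) : Prop :=
  exists X : m.-tuple E, (forall v, v \in X -> S v) /\ free X.

End Convexity.

Arguments simplex {R} n.

Notation upper N := {ij : 'I_N * 'I_N | (ij.1 < ij.2)%N}.

Section Transport.
Context {R : realType} {N : nat}.
Implicit Types (c p : 'M[R]_N) (mu nu : 'rV[R]_N).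

Definition couplings mu nu : set 'M[R]_N :=
  [set p | [/\ forall i j, 0 <= p i j,
               forall i, \sum_j p i j = mu 0 i &
               forall j, \sum_i p i j = nu 0 j]].

Definition frob c p : R := \sum_i \sum_j c i j * p i j.

(* For mu and nu in the simplex this infimum is a minimum: see
   ot_plans_nonempty and ot_cost_plan. *)
Definition ot_cost c mu nu : R := inf [set frob c p | p in couplings mu nu].

Definition ot_plans c mu nu : set 'M[R]_N :=
  [set p | couplings mu nu p /\
           forall q, couplings mu nu q -> frob c p <= frob c q].

Definition Sym0 : set 'M[R]_N :=
  [set c | (forall i, c i i = 0) /\ (forall i j, c i j = c j i)].

Definition symsum (x : 'M[R]_N) : {ffun upper N -> R^o} :=
  [ffun ij => x (val ij).1 (val ij).2 + x (val ij).2 (val ij).1].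

Definition consistent (K : nat) (mu nu : 'I_K -> 'rV[R]_N)
    (alpha : 'I_K -> R) (pi : 'I_K -> 'M[R]_N) : set 'M[R]_N :=
  [set ct | forall k, ot_cost ct (mu k) (nu k) = alpha k /\
                      alpha k = frob ct (pi k)].

Definition identifiable (K : nat) (mu nu : 'I_K -> 'rV[R]_N)
    (alpha : 'I_K -> R) (pi : 'I_K -> 'M[R]_N) (S : set 'M[R]_N) c : Prop :=
  S `&` consistent mu nu alpha pi = [set c].

End Transport.

Arguments Sym0 {R} N.

Section Facts.
Context {R : realType} {N : nat}.
Implicit Types (c p : 'M[R]_N) (mu nu : 'rV[R]_N).

Lemma card_upper : #|{: upper N}| = ((N.-1 * N)./2)%N.
Proof.
rewrite card_sig -sum1_card (eq_bigl (fun p : 'I_N * 'I_N => (p.1 < p.2)%N)) //.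
rewrite -(pair_big_dep xpredT (fun i j : 'I_N => (i < j)%N) (fun _ _ => 1%N)) /=.
rewrite (exchange_big_dep xpredT) //= mulnC -bin2 -bin2_sum big_mkord.
apply: eq_bigr => j _.
by rewrite -(big_ord_widen N (fun=> 1%N) (ltnW (ltn_ord j))) sum1_card card_ord.
Qed.

Lemma couplings_product mu nu :
  simplex N mu -> simplex N nu -> couplings mu nu (mu^T *m nu).
Proof.
move=> [mu0 mu1] [nu0 nu1].
have E i j : (mu^T *m nu) i j = mu 0 i * nu 0 j by rewrite mxE big_ord1 mxE.
split.
- by move=> i j; rewrite E mulr_ge0.
- by move=> i; under eq_bigr do rewrite E; rewrite -mulr_sumr nu1 mulr1.
- by move=> j; under eq_bigr do rewrite E; rewrite -mulr_suml mu1 mul1r.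
Qed.

Lemma ot_plans_nonempty c mu nu :
  simplex N mu -> simplex N nu -> ot_plans c mu nu !=set0.
Proof.
move=> hmu hnu.
pose A := [set v : 'rV[R]_(N * N) | couplings mu nu (vec_mx v)].
have vC i j : continuous (fun v : 'rV[R]_(N * N) => vec_mx v i j).
  rewrite (_ : (fun _ => _) = fun v : 'rV[R]_(N * N) => v 0 (mxvec_index i j)).
    exact: coord_continuous.
  by apply/funext => v; rewrite mxE.
have sum_cont (I : finType) (F : I -> 'rV[R]_(N * N) -> R) :
    (forall i, continuous (F i)) -> continuous (fun v => \sum_i F i v).
  move=> FC; apply: continuous_big => //.
  exact: add_continuous.
have A0 : A !=set0.
  exists (mxvec (mu^T *m nu)).
  by rewrite /A /= mxvecK; exact: couplings_product.
have Acl : closed A.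
  rewrite (_ : A =
      (\bigcap_(i in [set: 'I_N]) \bigcap_(j in [set: 'I_N])
         ((fun v => vec_mx v i j) @^-1` [set x | 0 <= x])) `&`
      (\bigcap_(i in [set: 'I_N])
         ((fun v => \sum_j vec_mx v i j) @^-1` [set x | x = mu 0 i])) `&`
      (\bigcap_(j in [set: 'I_N])
         ((fun v => \sum_i vec_mx v i j) @^-1` [set x | x = nu 0 j]))).
    apply: closedI; first apply: closedI.
    - apply: closed_bigI => i _; apply: closed_bigI => j _.
      by apply: preimage_closed; [move=> v _; exact: vC | exact: closed_ge].
    - apply: closed_bigI => i _.
      by apply: preimage_closed; [move=> v _; apply: sum_cont | exact: closed_eq].
    - apply: closed_bigI => j _.
      by apply: preimage_closed; [move=> v _; apply: sum_cont | exact: closed_eq].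
  apply/seteqP; split => v /=.
    by move=> [a b d]; split; [split=> i _ // j _|move=> j _]; rewrite /=.
  move=> [[a b] d]; split => [i j|i|j];
    [exact: (a i I j I)|exact: (b i I)|exact: (d j I)].
have Aco : compact A.
  apply: (@subclosed_compact _ _
    [set v : 'rV[R]_(N * N) | forall k, `[0, 1]%classic (v ord0 k)]) => //.
    by apply: (@rV_compact R _ (fun=> `[0, 1]%classic)) => k; exact: segment_compact.
  move=> v [a b d] k; case/mxvec_indexP: k => i j.
  have E i' j' : vec_mx v i' j' = v 0 (mxvec_index i' j') by rewrite mxE.
  rewrite /= in_itv /= -E a /=.
  apply: (@le_trans _ _ (mu 0 i)).
    by rewrite -b (bigD1 j) //= lerDl sumr_ge0.
  by rewrite -hmu.2 (bigD1 i) //= lerDl sumr_ge0 // => i' _; exact: hmu.1.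
have fC : continuous (fun v : 'rV[R]_(N * N) => frob c (vec_mx v)).
  apply: (sum_cont) => i; apply: (sum_cont) => j v.
  apply: (@cvgM R _ (nbhs v) _ (fun=> c i j) (fun w => vec_mx w i j)).
    exact: cvg_cst.
  exact: vC.
have [v vA vmin] := compact_EVT_min A0 Aco (continuous_subspaceT fC).
exists (vec_mx v); split; first by move: vA; rewrite inE.
move=> q hq; rewrite -[q]mxvecK; apply: vmin.
by rewrite inE /A /= mxvecK.
Qed.

Lemma ot_cost_plan c mu nu p : ot_plans c mu nu p -> ot_cost c mu nu = frob c p.
Proof.
move=> [hp pmin]; apply/eqP; rewrite eq_le; apply/andP; split.
  apply: ge_inf; last by exists p.
  by exists (frob c p) => _ [q hq <-]; exact: pmin.
apply: lb_le_inf; first by exists (frob c p), p.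
by move=> _ [q hq <-]; exact: pmin.
Qed.

End Facts.

(* Main.v *)
Require Import Defs.
From HB Require Import structures.
From mathcomp Require Import all_boot all_order all_algebra.
From mathcomp Require Import all_classical all_reals all_analysis.
From mathcomp Require Import lra.

(** Both parts compare two statements about the differences [d] of cost
    matrices in [Sym0 N]: that [d] is orthogonal to all the vertices
    [u k l], and that [d = 0].  On [Sym0 N] the pairing [frob d p] is the
    ordinary scalar product of the upper triangle of [d] with [symsum p]
    ([frob_symsum]), so orthogonality to all the vertices forces [d = 0]
    exactly when the vectors [symsum (u k l)] span the space of upper
    triangles, whose dimension is [(N.-1 * N)./2]
    ([free_annihilator0], [exists_annihilator]).

    For a), let [c'] be consistent.  The plan [pi k] is a convex combination
    with positive weights of the [u k l], its [c']-cost is the minimum over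
    all couplings, and hence every [u k l] has that same [c']-cost
    ([convex_comb_min]).  So [c' - c] is orthogonal to all the vertices.

    For b), if the vectors do not span, some nonzero [d] in [Sym0 N] is
    orthogonal to all the vertices, and [c + t *: d] is a second consistent
    matrix for small [t > 0].  Its value on [pi k] is still [alpha k]; what
    needs an argument is that no coupling gets a smaller cost.  On the
    [c]-optimal couplings, which by hypothesis are convex combinations of
    the [u k l], the perturbation changes nothing.  The others are not
    bounded away from optimality, but it is enough to look at a finite set of
    couplings on which every linear cost attains its minimum
    ([cost_perturbation]).  The finite set used here consists of the couplings
    that are determined by their support; there are finitely many
    because there are finitely many supports, and a cost attains its minimum
    on one of them because a minimizer of minimal support is of this kind
    ([basic_ot_plan]). *)

Set Implicit Arguments.
Unset Strict Implicit.
Unset Printing Implicit Defensive.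

Import Order.TTheory GRing.Theory Num.Theory.

Local Open Scope classical_set_scope.
Local Open Scope ring_scope.

(** * Spanning sets and their annihilators *)

Lemma dim_ffun_regular (R : fieldType) (T : finType) :
  \dim {:{ffun T -> R^o}} = #|T|.
Proof. by rewrite dimvf /dim /= muln1. Qed.

Lemma ffun_delta_decomp (R : fieldType) (T : finType) (v : {ffun T -> R^o}) :
  v = \sum_x v x *: [ffun y => (y == x)%:R : R^o].
Proof.
apply/ffunP => y; rewrite sum_ffunE (bigD1 y) //= !ffunE eqxx big1 => [|x /negPf xy].
  by rewrite addr0; exact/esym/mulr1.
by rewrite !ffunE eq_sym xy scaler0.
Qed.

(** Going through the sequence from its end, keep a vector only when the span
    of those already kept does not contain it. *)
Lemma free_subseq_span (F : fieldType) (V : vectType F) (s : seq V) :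
  exists X : seq V, [/\ {subset X <= s}, free X & <<X>>%VS = << s >>%VS].
Proof.
elim: s => [|v s [X [Xs Xfree spanX]]]; first by exists [::]; rewrite nil_free.
have [vX | vX] := boolP (v \in <<X>>%VS).
  exists X; split=> //; first by move=> x /Xs xs; rewrite inE xs orbT.
  by rewrite span_cons -spanX; symmetry; apply/addv_idPr; rewrite -memvE.
exists (v :: X); split; last by rewrite !span_cons spanX.
  by move=> x; rewrite !inE => /orP[->|/Xs ->]; rewrite ?orbT.
by rewrite free_cons vX.
Qed.

(** A free family of maximal size spans, so the linear form given by [a]
    vanishes on the basis of indicator functions. *)
Lemma free_annihilator0 (R : realType) (T : finType)
    (S : set {ffun T -> R^o}) (a : T -> R) :
  contains_free S #|T| -> (forall v, S v -> \sum_x a x * v x = 0) ->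
  forall x, a x = 0.
Proof.
move=> [X [XS Xfree]] aS x.
have spanX : <<X>>%VS = fullv.
  apply/eqP; rewrite eqEdim subvf dim_ffun_regular /=.
  by rewrite (eqP Xfree) size_tuple.
pose e : {ffun T -> R^o} := [ffun y => (y == x)%:R].
have eX : e \in <<X>>%VS by rewrite spanX memvf.
have [k eE _] := free_span Xfree eX.
have -> : a x = \sum_y a y * e y.
  rewrite (bigD1 x) //= ffunE eqxx mulr1 big1 ?addr0 // => y /negPf yx.
  by rewrite ffunE yx mulr0.
under eq_bigr do rewrite eE sum_ffunE mulr_sumr.
rewrite exchange_big /= big_seq big1 // => v vX.
have -> : \sum_y a y * (k v *: v) y = k v * \sum_y a y * v y.
  by rewrite mulr_sumr; apply: eq_bigr => y _; rewrite ffunE [_ *: _]/(_ * _) mulrCA.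
by rewrite aS ?mulr0 //; exact: XS.
Qed.

(** The form is a nonzero coordinate of the projection along the span, which
    kills the span but not a chosen vector [w] outside it. *)
Lemma exists_annihilator (R : realType) (T : finType) (s : seq {ffun T -> R^o}) :
  ~ contains_free [set v | v \in s] #|T| ->
  exists a : T -> R, (exists x, a x != 0) /\
                     forall v, v \in s -> \sum_x a x * v x = 0.
Proof.
move=> nfree; have [X [Xs Xfree spanX]] := free_subseq_span s.
have [w wX] : exists w, w \notin <<X>>%VS.
  apply/not_existsP => Xall; apply: nfree.
  have Xfull : <<X>>%VS = fullv.
    by apply/vspaceP => w; rewrite memvf; apply: contrapT => /negP /Xall.
  have Xsize : size X == #|T| by rewrite -(dim_ffun_regular R) -Xfull (eqP Xfree).
  by exists (Tuple Xsize); split.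
pose g (v : {ffun T -> R^o}) : {ffun T -> R^o} := v - projv <<X>> v.
have [x gwx] : exists x, g w x != 0.
  apply/not_existsP => gw0; move/negP: wX; apply.
  have /eqP : g w = 0.
    by apply/ffunP => x; rewrite [RHS]ffunE; apply: contrapT => /eqP /gw0.
  by rewrite subr_eq0 => /eqP ->; exact: memv_proj.
(* A linear form is its scalar product with its values on indicators. *)
pose a y : R := g [ffun z => (z == y)%:R : R^o] x.
have gE (v : {ffun T -> R^o}) : \sum_y a y * v y = g v x.
  rewrite [in RHS](ffun_delta_decomp v) /g linear_sum -sumrB sum_ffunE.
  apply: eq_bigr => y _; rewrite linearZ -scalerBr ffunE.
  by rewrite [_ *: _]/(_ * _) mulrC.
exists a; split.
  apply: contrapT => a0; move/negP: gwx; apply; rewrite -gE big1 // => y _.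
  have -> : a y = 0 by apply: contrapT => /eqP ay; apply: a0; exists y.
  by rewrite mul0r.
move=> v vs; have vX : v \in <<X>>%VS by rewrite spanX memv_span.
by rewrite gE /g projv_id // subrr ffunE.
Qed.

(** * The Frobenius pairing on symmetric cost matrices *)

Section Frobenius.
Variables (R : realType) (N : nat).
Implicit Types c d p q : 'M[R]_N.

Lemma frobC c p : frob c p = frob p c.
Proof. by apply: eq_bigr => i _; apply: eq_bigr => j _; exact: mulrC. Qed.

Lemma frobDl c d p : frob (c + d) p = frob c p + frob d p.
Proof.
rewrite -big_split; apply: eq_bigr => i _; rewrite -big_split.
by apply: eq_bigr => j _; rewrite mxE mulrDl.
Qed.

Lemma frobZl t c p : frob (t *: c) p = t * frob c p.
Proof.
rewrite mulr_sumr; apply: eq_bigr => i _; rewrite mulr_sumr.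
by apply: eq_bigr => j _; rewrite mxE mulrA.
Qed.

Lemma frob_sumr (L : nat) c (a : 'I_L -> R) (v : 'I_L -> 'M[R]_N) :
  frob c (\sum_l a l *: v l) = \sum_l a l * frob c (v l).
Proof.
have frob0 : frob 0 c = 0.
  by rewrite /frob big1 // => i _; rewrite big1 // => j _; rewrite mxE mul0r.
rewrite frobC (big_morph (frob^~ c) (fun p q => frobDl p q c) frob0).
by apply: eq_bigr => l _; rewrite frobZl frobC.
Qed.

(** The diagonal terms vanish, and the terms at [(i, j)] and [(j, i)] share the
    coefficient [d i j]. *)
Lemma frob_symsum d p : Sym0 N d ->
  frob d p = \sum_(ij : upper N) d (val ij).1 (val ij).2 * symsum p ij.
Proof.
move=> [d0 dsym].
pose F (ij : 'I_N * 'I_N) := d ij.1 ij.2 * p ij.1 ij.2.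
pose swap (ij : 'I_N * 'I_N) := (ij.2, ij.1).
have swapK : involutive swap by case.
transitivity (\sum_(ij : 'I_N * 'I_N | (ij.1 < ij.2)%N) (F ij + F (swap ij))).
  rewrite /frob pair_bigA /= (bigID (fun ij : 'I_N * 'I_N => (ij.1 < ij.2)%N)) /=.
  rewrite big_split /=; congr (_ + _).
  rewrite [RHS](reindex_inj (inv_inj swapK)) /=.
  rewrite big_mkcond [RHS]big_mkcond; apply: eq_bigr => -[i j] _ /=.
  rewrite -leqNgt /F /=; case: ltngtP => // ij.
  by rewrite (val_inj ij) d0 mul0r.
rewrite (big_sub (fun ij : 'I_N * 'I_N => (ij.1 < ij.2)%N)) /=.
by apply: eq_bigr => ij _; rewrite ffunE mulrDr /F /= [d (val ij).2 _]dsym.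
Qed.

(** At most one of the two summands is nonzero: [insub] fails on a pair that
    is not strictly increasing. *)
Definition sym_of_upper (a : upper N -> R) : 'M[R]_N :=
  \matrix_(i, j) (oapp a 0 (insub (i, j)) + oapp a 0 (insub (j, i))).

Lemma sym_of_upper_Sym0 a : Sym0 N (sym_of_upper a).
Proof.
split=> [i|i j]; last by rewrite !mxE addrC.
by rewrite mxE insubF /= ?ltnn // addr0.
Qed.

Lemma sym_of_upperE a (ij : upper N) : sym_of_upper a (val ij).1 (val ij).2 = a ij.
Proof.
case: ij => -[i j] /= ij; rewrite mxE insubT /= insubF ?addr0 //=.
by rewrite ltnNge ltnW.
Qed.

Lemma ot_cost_le c mu nu p : simplex N mu -> simplex N nu ->
  couplings mu nu p -> ot_cost c mu nu <= frob c p.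
Proof.
move=> hmu hnu hp; have [q hq] := ot_plans_nonempty c hmu hnu.
by rewrite (ot_cost_plan hq); exact: hq.2.
Qed.

End Frobenius.

(** * Optimal couplings determined by their support *)

Section Basic.
Variables (R : realType) (N : nat).
Implicit Types (c d p q : 'M[R]_N) (mu nu : 'rV[R]_N).

Definition mx_support q : {set 'I_N * 'I_N} := [set ij | q ij.1 ij.2 != 0]%SET.

(** These are the basic feasible solutions of the transport problem.  Being
    determined by the support is the form of extremality that makes their
    finiteness immediate. *)
Definition basic_coupling mu nu q : Prop :=
  couplings mu nu q /\
  forall p, couplings mu nu p -> mx_support p \subset mx_support q -> p = q.

Lemma couplings_line mu nu p q (t : R) :
  couplings mu nu p -> couplings mu nu q ->
  (forall i j, 0 <= (q + t *: (q - p)) i j) -> couplings mu nu (q + t *: (q - p)).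
Proof.
move=> [_ prow pcol] [_ qrow qcol] r0; split=> // [i|j].
  under eq_bigr do rewrite !mxE.
  by rewrite big_split /= -mulr_sumr sumrB qrow prow subrr mulr0 addr0.
under eq_bigr do rewrite !mxE.
by rewrite big_split /= -mulr_sumr sumrB qcol pcol subrr mulr0 addr0.
Qed.

(** Equal row sums: a row of [q - p] without negative entry sums to zero, so
    it is zero. *)
Lemma couplings_neq_lt mu nu p q :
  couplings mu nu p -> couplings mu nu q -> p <> q ->
  exists ij : 'I_N * 'I_N, q ij.1 ij.2 < p ij.1 ij.2.
Proof.
move=> [_ prow _] [_ qrow _] pq; apply/not_existsP => qp; apply: pq.
apply/matrixP => i j; apply/eqP; rewrite eq_sym -subr_eq0.
have le_pq k : 0 <= q i k - p i k.
  by rewrite subr_ge0 leNgt; apply/negP => lt_qp; exact: (qp (i, k)).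
have sum0 : \sum_k (q i k - p i k) == 0 by rewrite sumrB qrow prow subrr.
by have := psumr_eq0P (fun k _ => le_pq k) (eqP sum0) (erefl : xpredT j) => ->.
Qed.

(** Move from [q] away from [p].  The cost cannot increase, since [q] is
    optimal, and the support cannot grow.  The entries at which [q < p]
    decrease, so at some moment a first one of them reaches zero; stopping
    there gives the coupling [r]. *)
Lemma ot_plans_smaller_support c mu nu p q :
  ot_plans c mu nu q -> couplings mu nu p -> p <> q ->
  mx_support p \subset mx_support q ->
  exists r, ot_plans c mu nu r /\ mx_support r \proper mx_support q.
Proof.
move=> [hq qmin] hp pq supp_pq.
have [q0 _ _] := hq.
have [ij0 lt0] := couplings_neq_lt hp hq pq.
(* The step length at which the entry [ij] reaches zero. *)
pose ratio (ij : 'I_N * 'I_N) : R := q ij.1 ij.2 / (p ij.1 ij.2 - q ij.1 ij.2).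
have [ij /= lt_ij ij_min] := @arg_minP _ _ _ ij0
  (fun ij : 'I_N * 'I_N => q ij.1 ij.2 < p ij.1 ij.2) ratio lt0.
have t0 : 0 <= ratio ij by rewrite divr_ge0 ?q0 // subr_ge0 ltW.
set t := ratio ij in t0 ij_min.
have tE : t * (p ij.1 ij.2 - q ij.1 ij.2) = q ij.1 ij.2.
  by rewrite divfK // subr_eq0 gt_eqF.
have r0 i j : 0 <= (q + t *: (q - p)) i j.
  rewrite !mxE -(opprB (p i j)) mulrN. rewrite subr_ge0.
  have [le_pq|lt_qp] := leP (p i j) (q i j).
    rewrite (le_trans _ (q0 i j)) // mulr_ge0_le0 // subr_le0 //.
  by have := ij_min (i, j) lt_qp; rewrite ler_pdivlMr // subr_gt0.
exists (q + t *: (q - p)); split.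
  split; first exact: couplings_line.
  move=> s hs; apply: le_trans (qmin _ hs).
  rewrite frobC frobDl frobZl -scaleN1r frobDl frobZl !(frobC _ c).
  rewrite gerDl mulr_ge0_le0 // mulN1r subr_le0; exact: qmin.
apply/properP; split.
  apply/fintype.subsetP => kl; rewrite !inE; apply: contraNN => /eqP qkl.
  have /eqP p0 : p kl.1 kl.2 == 0.
    by have := fintype.subsetP supp_pq kl; rewrite !inE qkl eqxx; case: eqP => // _ /(_ isT).
  by rewrite !mxE qkl p0 subrr mulr0 addr0.
exists ij; rewrite inE.
  have := fintype.subsetP supp_pq ij; rewrite !inE; apply.
  by rewrite gt_eqF // (le_lt_trans _ lt_ij) // q0.
by rewrite negbK !mxE -(opprB (p _ _)) mulrN tE subrr.
Qed.

(** A minimizer of minimal support is basic, since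
    [ot_plans_smaller_support] would otherwise reduce its support. *)
Lemma basic_ot_plan c mu nu : simplex N mu -> simplex N nu ->
  exists q, ot_plans c mu nu q /\ basic_coupling mu nu q.
Proof.
move=> hmu hnu; have [q] := ot_plans_nonempty c hmu hnu.
have [n] := ubnP #|mx_support q|; elim: n q => // n IHn q lt_qn hq.
have [qbasic | /not_andP[|]] := pselect (basic_coupling mu nu q).
- by exists q.
- by case: hq.
move=> /existsNP[p /not_implyP[hp /not_implyP[supp_pq pq]]].
have [r [hr lt_rq]] := ot_plans_smaller_support hq hp pq supp_pq.
by apply: IHn hr; rewrite (leq_trans (proper_card lt_rq)).
Qed.

(** The condition on [d] at the couplings of cost [m] says that moving the
    cost in direction [d] does not decrease them.  The margin
    [frob c q - m] at the other couplings has no positive lower bound, but a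
    bound on [t] is needed only for basic couplings, one for each
    support, and finitely many bounds can be met together. *)
Lemma cost_perturbation c d mu nu (m : R) :
  simplex N mu -> simplex N nu ->
  (forall q, couplings mu nu q -> m <= frob c q) ->
  (forall q, couplings mu nu q -> frob c q = m -> 0 <= frob d q) ->
  \forall t \near 0^'+, forall q, couplings mu nu q -> m <= frob (c + t *: d) q.
Proof.
move=> hmu hnu cmin dmin.
have nearB : \forall t \near (0 : R)^'+, forall S : {set 'I_N * 'I_N},
    forall q, basic_coupling mu nu q -> mx_support q = S ->
    m <= frob (c + t *: d) q.
  apply: filter_forall => S.
  have [[q [qB qS]] | noq] :=
      pselect (exists q, basic_coupling mu nu q /\ mx_support q = S); last first.
    by near=> t => q qB qS; case: noq; exists q.
  have nearq : \forall t \near (0 : R)^'+, m <= frob (c + t *: d) q.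
    have [cq | /eqP cq] := eqVneq (frob c q) m.
      near=> t; have t0 : 0 <= t by near: t; exact: nbhs_right_ge.
      by rewrite frobDl frobZl cq lerDl mulr_ge0 // dmin //; case: qB.
    have gap : 0 < frob c q - m by rewrite subr_gt0 lt_def (cmin _ qB.1) andbT; apply/eqP.
    (* The [+ 1] avoids a division by zero when [frob d q = 0]. *)
    have bnd_gt0 : 0 < (frob c q - m) / (`|frob d q| + 1).
      by rewrite divr_gt0 // ltr_pwDr.
    near=> t; have t0 : 0 < t by near: t; exact: nbhs_right_gt.
    have : t * (`|frob d q| + 1) < frob c q - m.
      by rewrite -ltr_pdivlMr ?ltr_pwDr //; near: t; exact: nbhs_right_lt.
    have : t * - `|frob d q| <= t * frob d q by rewrite ler_pM2l // lerNnormlW.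
    rewrite frobDl frobZl; lra.
  by apply: filterS nearq => t tq p pB pS; rewrite (qB.2 p) // ?pS ?qS //; case: pB.
apply: filterS nearB => t tB q hq.
have [p [pmin pB]] := basic_ot_plan (c + t *: d) hmu hnu.
by apply: le_trans (tB _ p pB erefl) (pmin.2 q hq).
Unshelve. all: by end_near.
Qed.

End Basic.

(** * Convex combinations and identifiability *)

Lemma conv_family_vertex (R : realType) (E : lmodType R) (L : nat)
    (v : 'I_L -> E) l : conv_family v (v l).
Proof.
exists (\row_m (m == l)%:R); first split=> [m|].
- by rewrite mxE.
- by rewrite (bigD1 l) //= mxE eqxx big1 ?addr0 // => m /negPf ml; rewrite mxE ml.
rewrite (bigD1 l) //= mxE eqxx scale1r big1 ?addr0 // => m /negPf ml.
by rewrite mxE ml scale0r.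
Qed.

(** An average with positive weights attains the lower bound of its terms only
    if they all do. *)
Lemma convex_comb_min (R : realType) (L : nat) (lam x : 'I_L -> R) (m : R) :
  \sum_l lam l = 1 -> (forall l, 0 < lam l) -> (forall l, m <= x l) ->
  \sum_l lam l * x l = m -> forall l, x l = m.
Proof.
move=> lam1 lam0 xm sumx l.
have sum0 : \sum_l lam l * (x l - m) = 0.
  by under eq_bigr do rewrite mulrBr; rewrite sumrB sumx -mulr_suml lam1 mul1r subrr.
have ge0 k : true -> 0 <= lam k * (x k - m).
  by rewrite mulr_ge0 ?(ltW (lam0 k)) // subr_ge0.
have /eqP := psumr_eq0P ge0 sum0 (erefl : xpredT l).
by rewrite mulf_eq0 gt_eqF //= subr_eq0 => /eqP.
Qed.

Theorem theorem2p38 (R : realType) (K N : nat)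
    (mu nu : 'I_K -> 'rV[R]_N) (alpha : 'I_K -> R) (pi : 'I_K -> 'M[R]_N)
    (c : 'M[R]_N) (L : 'I_K -> nat) (u : forall k : 'I_K, 'I_(L k) -> 'M[R]_N)
    (hmu : forall k, simplex N (mu k)) (hnu : forall k, simplex N (nu k))
    (hdistinct : injective (fun k => (mu k, nu k)))
    (hpi : forall k, couplings (mu k) (nu k) (pi k))
    (hc : Sym0 N c)
    (hobs : consistent mu nu alpha pi c)
    (huEP : forall k l, extreme_points (couplings (mu k) (nu k)) (u k l))
    (hurep : forall k, exists lambda : 'rV[R]_(L k),
       [/\ simplex (L k) lambda, forall l, 0 < lambda 0 l &
           pi k = \sum_l lambda 0 l *: u k l])
    (huOTP : forall k, conv_family (u k) `<=` ot_plans c (mu k) (nu k)) :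
  (contains_free [set v | exists k l, v = symsum (u k l)] ((N.-1 * N)./2)%N ->
   identifiable mu nu alpha pi (Sym0 N) c)
  /\
  ((forall k, conv_family (u k) = ot_plans c (mu k) (nu k)) ->
   identifiable mu nu alpha pi (Sym0 N) c ->
   contains_free [set v | exists k l, v = symsum (u k l)] ((N.-1 * N)./2)%N).
Proof.
have cu k l : frob c (u k l) = alpha k.
  have := huOTP k _ (conv_family_vertex (u k) l).
  by move=> /ot_cost_plan <-; rewrite (hobs k).1.
have piE k d : exists lam : 'I_(L k) -> R,
    [/\ \sum_l lam l = 1, forall l, 0 < lam l &
        frob d (pi k) = \sum_l lam l * frob d (u k l)].
  have [lam [lam1 lam0 ->]] := hurep k.
  by exists (lam 0); split; [exact: lam1.2 | | rewrite frob_sumr].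
rewrite -card_upper; split=> [cfree | uOTP /seteqP[cid _]].
  apply/seteqP; split=> [c' [c'sym c'obs] | _ ->] //=.
  have c'u k l : frob c' (u k l) = alpha k.
    have [lam [lam1 lam0 c'pi]] := piE k c'.
    apply: (convex_comb_min lam1 lam0 (x := fun l => frob c' (u k l))) => [j|].
      by rewrite -(c'obs k).1 ot_cost_le //; case: (huEP k j).
    by rewrite -c'pi -(c'obs k).2.
  have dsym : Sym0 N (c' - c).
    case: hc c'sym => c0 cs [c'0 c's].
    by split=> [i|i j]; rewrite !mxE ?c0 ?c'0 ?subrr // cs c's.
  have d_orth v : [set v | exists k l, v = symsum (u k l)] v ->
      \sum_(ij : upper N) (c' - c) (val ij).1 (val ij).2 * v ij = 0.
    move=> [k [l ->]]; rewrite -frob_symsum // -scaleN1r frobDl frobZl c'u cu.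
    by rewrite mulN1r subrr.
  have d0 := free_annihilator0 cfree d_orth.
  have d0' (i j : 'I_N) : (i < j)%N -> (c' - c) i j = 0.
    by move=> ij; exact: (d0 (exist _ (i, j) ij)).
  apply/subr0_eq/matrixP => i j; rewrite [RHS]mxE.
  case: (ltngtP i j) => [/d0' //|/d0' ji|/val_inj ->]; last exact: dsym.1.
  by rewrite dsym.2.
apply: contrapT => nfree.
pose I := {k : 'I_K & 'I_(L k)}.
pose s := [seq symsum (u (tag kl) (tagged kl)) | kl : I].
have su k l : symsum (u k l) \in s by apply/fintype.imageP; exists (Tagged (fun k => 'I_(L k)) l).
have [|a [[ij aij] a_orth]] := exists_annihilator (s := s).
  move=> [X [Xs Xfree]]; apply: nfree; exists X; split=> // v /Xs.
  by move=> /fintype.imageP[[k l] _ ->]; exists k, l.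
pose d := sym_of_upper a.
have dsym : Sym0 N d by exact: sym_of_upper_Sym0.
have du k l : frob d (u k l) = 0.
  rewrite frob_symsum // -[RHS](a_orth _ (su k l)).
  by apply: eq_bigr => kl _; rewrite sym_of_upperE.
have dpi k : frob d (pi k) = 0.
  have [lam [_ _ ->]] := piE k d.
  by rewrite big1 // => l _; rewrite du mulr0.
have cmin k q : couplings (mu k) (nu k) q -> alpha k <= frob c q.
  by move=> hq; rewrite -(hobs k).1 ot_cost_le.
(* This is where the optimal couplings have to be no more than [conv u]. *)
have dface k q : couplings (mu k) (nu k) q -> frob c q = alpha k -> 0 <= frob d q.
  move=> hq cq; have : conv_family (u k) q.
    by rewrite uOTP; split=> // r hr; rewrite cq cmin.
  by move=> [lam _ <-]; rewrite frob_sumr big1 // => l _; rewrite du mulr0.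
have near_opt : \forall t \near (0 : R)^'+, forall k q,
    couplings (mu k) (nu k) q -> alpha k <= frob (c + t *: d) q.
  apply: filter_forall => k.
  exact: (cost_perturbation (hmu k) (hnu k) (cmin k) (@dface k)).
have [t [t0 t_opt]] : exists t : R, 0 < t /\ forall k q,
    couplings (mu k) (nu k) q -> alpha k <= frob (c + t *: d) q.
  by apply: (@filter_ex _ (0 : R)^'+); apply: filterI near_opt; exact: nbhs_right_gt.
have ct_pi k : frob (c + t *: d) (pi k) = alpha k.
  by rewrite frobDl frobZl dpi mulr0 addr0 -(hobs k).2.
have ct_id : c + t *: d = c.
  apply: cid; split.
    case: hc dsym => c0 cs [d0 ds].
    by split=> [i|i j]; rewrite mxE [X in _ + X]mxE ?c0 ?d0 ?mulr0 ?addr0 // cs ds !mxE.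
  move=> k; rewrite ct_pi; split=> //.
  rewrite (@ot_cost_plan _ _ _ _ _ (pi k)) ?ct_pi //.
  by split=> // q hq; rewrite ct_pi t_opt.
move/eqP: ct_id; rewrite addrC -subr_eq0 addrK scaler_eq0 gt_eqF //= => /eqP d0.
by move/negP: aij; apply; rewrite -sym_of_upperE -/d d0 mxE.
Qed.
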